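(* Let $\mathcal{G}_1$ and $\mathcal{G}_2$ be connected directed heterogeneous multigraphs with reversed edges, and let $\mathcal{H}_1 = L(\mathcal{G}_1)$ and $\mathcal{H}_2 = L(\mathcal{G}_2)$ be their line graphs. Then there is a one-to-one correspondence (bijection) between the set of isomorphisms from $\mathcal{G}_1$ to $\mathcal{G}_2$ and the set of isomorphisms from $\mathcal{H}_1$ to $\mathcal{H}_2$.
   Context: **Graphs.** A directed heterogeneous multigraph (simply ''graph'') $\mathcal{G}$ consists of a vertex set $\mathcal{V}_{\mathcal{G}}$, an edge set $\mathcal{E}_{\mathcal{G}} \subseteq \mathcal{V}_{\mathcal{G}} \times \mathcal{V}_{\mathcal{G}}$ (self-loops allowed), a function $\mathcal{X}_{\mathcal{G}}$ assigning to each vertex a vertex label, and a function $\mathcal{Y}_{\mathcal{G}}$ assigning to each edge a set of edge labels (parallel edges with the same source and target are merged into one edge carrying several labels). For an edge $e=(u,v)$, write $e.\text{source}=u$ and $e.\text{target}=v$. By convention $\mathcal{Y}_{\mathcal{G}}((u,v)) = \phi$ if $(u,v)\notin\mathcal{E}_{\mathcal{G}}$, where $\phi$ is a value that is never the label of an actual edge. **With reversed edges.** $\mathcal{G}$ is ''with reversed edges'' if for every $(u,v)\in\mathcal{E}_{\mathcal{G}}$ also $(v,u)\in\mathcal{E}_{\mathcal{G}}$ (the reverse of a self-loop is itself). No relation is required between the labels of an edge and of its reverse. **Isomorphism.** An isomorphism from $\mathcal{G}_1$ to $\mathcal{G}_2$ is a bijection $f:\mathcal{V}_{\mathcal{G}_1}\to\mathcal{V}_{\mathcal{G}_2}$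 such that - $\mathcal{X}_{\mathcal{G}_1}(v)=\mathcal{X}_{\mathcal{G}_2}(f(v))$ for all $v\in\mathcal{V}_{\mathcal{G}_1}$, and $\mathcal{X}_{\mathcal{G}_2}(v')=\mathcal{X}_{\mathcal{G}_1}(f^{-1}(v'))$ for all $v'\in\mathcal{V}_{\mathcal{G}_2}$; - $\mathcal{Y}_{\mathcal{G}_1}((u,v))=\mathcal{Y}_{\mathcal{G}_2}((f(u),f(v)))$ for all $(u,v)\in\mathcal{E}_{\mathcal{G}_1}$, and $\mathcal{Y}_{\mathcal{G}_2}((u',v'))=\mathcal{Y}_{\mathcal{G}_1}((f^{-1}(u'),f^{-1}(v')))$ for all $(u',v')\in\mathcal{E}_{\mathcal{G}_2}$. The (unique) isomorphism between two empty graphs is the empty map $\{\}\to\{\}$. **Line graph.** The line graph (edge-to-vertex dual graph) $\mathcal{H}=L(\mathcal{G})$ of $\mathcal{G}$ has a vertex set $\mathcal{V}_{\mathcal{H}}$ in bijection with $\mathcal{E}_{\mathcal{G}}$ via a map $g:\mathcal{E}_{\mathcal{G}}\to\mathcal{V}_{\mathcal{H}}$ (the edge-to-vertex map). Vertex labels are $\mathcal{X}_{\mathcal{H}}(g(e))=\mathcal{Y}_{\mathcal{G}}(e)$. For $d,e\in\mathcal{E}_{\mathcal{G}}$ (possibly $d=e$), $(g(d),g(e))\in\mathcal{E}_{\mathcal{H}}$ if and only if $d.\text{target}=e.\text{source}$, and in that case $\mathcal{Y}_{\mathcal{H}}((g(d),g(e)))=\mathcal{X}_{\mathcal{G}}(d.\text{target})$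 (a vertex label being regarded as an edge label).
   Formalization: Added assumption: if neither graph has an edge, the same set of vertex labels occurs in both; without it two single edgeless vertices with different labels have no isomorphism while their empty line graphs have exactly one. *)

(* Defs.v *)
From mathcomp Require Import all_boot.
From mathcomp Require Import boolp classical_sets.

Set Implicit Arguments.
Unset Strict Implicit.
Unset Printing Implicit Defensive.

Local Open Scope classical_set_scope.

(* Vertices may be infinite in number. Parallel edges are merged: an edge is
   an ordered pair of vertices, carrying a set of edge labels. *)
Record graph (VL EL : Type) := Graph {
  vertex : Type;
  edge : set (vertex * vertex);
  vlabel : vertex -> VL;
  elabel : edge -> set EL
}.
Arguments edge {VL EL} g _.
Arguments vlabel {VL EL} g _.
Arguments elabel {VL EL} g _.

Section Graph.
Variables (VL EL : Type) (G : graph VL EL).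

Definition source (e : edge G) : vertex G := (val e).1.
Definition target (e : edge G) : vertex G := (val e).2.

(* [elabel] extended to all pairs; [None] is the value phi of the non-edges,
   hence distinct from every label set, including the empty one. *)
Definition elabel_ext (p : vertex G * vertex G) : option (set EL) :=
  omap (elabel G) (insub p).

Definition with_reversed_edges : Prop :=
  forall u v, edge G (u, v) -> edge G (v, u).

(* Connectedness disregards the direction of the edges. The graph without
   vertices counts as connected. *)
Definition connected : Prop :=
  forall u v : vertex G, exists p : seq (vertex G),
    path (fun x y => ((x, y) \in edge G) || ((y, x) \in edge G)) u p /\
    last u p = v.

End Graph.
Arguments elabel_ext {VL EL} G p.

Section Isomorphism.
Variables (VL EL : Type) (G1 G2 : graph VL EL).

Definition is_isomorphism (f : vertex G1 -> vertex G2) : Prop :=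
  exists f' : vertex G2 -> vertex G1,
    [/\ cancel f f' /\ cancel f' f,
        forall v, vlabel G1 v = vlabel G2 (f v),
        forall v', vlabel G2 v' = vlabel G1 (f' v'),
        forall u v, edge G1 (u, v) ->
          elabel_ext G1 (u, v) = elabel_ext G2 (f u, f v)
      & forall u' v', edge G2 (u', v') ->
          elabel_ext G2 (u', v') = elabel_ext G1 (f' u', f' v')].

Definition isomorphisms : set (vertex G1 -> vertex G2) :=
  [set f | is_isomorphism f].

End Isomorphism.
Arguments isomorphisms {VL EL} G1 G2 _.

(* [H] is the line graph of [G], which is defined only up to the naming of its
   vertices by the edge-to-vertex map [g]. The vertex labels of [H] are the
   label sets of the edges of [G]; a vertex label [x] of [G] regarded as an
   edge label of [H] gives the label set [[set x]]. *)
Definition is_line_graph (VL EL : Type) (G : graph VL EL)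
    (H : graph (set EL) VL) : Prop :=
  exists g : edge G -> vertex H,
    [/\ bijective g,
        forall e, vlabel H (g e) = elabel G e,
        forall d e, edge H (g d, g e) <-> target d = source e
      & forall d e, target d = source e ->
          elabel_ext H (g d, g e) = Some [set vlabel G (target d)]].

(* Main.v *)
(** An isomorphism [f] of graphs acts on edges by [(u, v) |-> (f u, f v)].
    Conversely, an isomorphism of the line graphs amounts to a bijection [psi]
    between the edges that preserves and reflects "the target of [d] is the
    source of [e]". As edges come with their reverses, as soon as there is an
    edge every vertex [v] of a connected graph is both a source and a target;
    every edge into [v] is followed by every edge out of [v], so the images of
    all these edges under [psi] meet at one common vertex, the only possible
    value of [f v]. A connected graph without edges has at most one vertex, and
    then [f] is determined by the vertex label. *)

Require Import Defs.
From mathcomp Require Import all_boot.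
From mathcomp Require Import boolp classical_sets.

Set Implicit Arguments.
Unset Strict Implicit.
Unset Printing Implicit Defensive.

Local Open Scope classical_set_scope.

(** Choice gives a function in each direction, and uniqueness makes the two mutually inverse. *)
Lemma bijective_of_rel (A B : Type) (R : A -> B -> Prop) :
    (forall a, exists! b, R a b) -> (forall b, exists! a, R a b) ->
  exists2 F : A -> B, bijective F & forall a, R a (F a).
Proof.
move=> totR surR.
have /choice[F FP] a : exists b, R a b.
  by have [b [Rab _]] := totR a; exists b.
have /choice[F' F'P] b : exists a, R a b.
  by have [a [Rab _]] := surR b; exists a.
exists F => //; exists F' => [a|b].
  have [a' [_ uniq_a]] := surR (F a).
  exact: etrans (esym (uniq_a _ (F'P _))) (uniq_a _ (FP a)).
have [b' [_ uniq_b]] := totR (F' b).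
exact: etrans (esym (uniq_b _ (FP _))) (uniq_b _ (F'P b)).
Qed.

(** * Edges and their endpoints in connected graphs *)

Section Graph.
Variables (VL EL : Type) (G : graph VL EL).

Lemma elabel_ext_edge (e : edge G) : elabel_ext G (val e) = Some (elabel G e).
Proof. by rewrite /elabel_ext valK. Qed.

Lemma edge_isSome p : edge G p = isSome (elabel_ext G p).
Proof.
rewrite /elabel_ext; case: insubP => [e /set_mem Gp _|/negP nGp];
  by apply/propext; split=> // /mem_set.
Qed.

Lemma elabel_ext_None p : ~ edge G p -> elabel_ext G p = None.
Proof. by rewrite edge_isSome; case: elabel_ext. Qed.

Lemma val_edge (e : edge G) : val e = (source e, target e).
Proof. exact: surjective_pairing. Qed.

Lemma edge_ext (d e : edge G) :
  source d = source e -> target d = target e -> d = e.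
Proof.
by move=> ds dt; apply: val_inj; rewrite !val_edge ds dt.
Qed.

Lemma mk_edge u v : edge G (u, v) ->
  exists e : edge G, source e = u /\ target e = v.
Proof. by move=> /mem_set Guv; exists (exist (fun p => p \in edge G) _ Guv). Qed.

Lemma edgeP (e : edge G) : edge G (source e, target e).
Proof. by rewrite -val_edge; apply: set_valP. Qed.

Hypothesis conn : connected G.

Lemma edgeless_connected : (edge G -> False) -> forall u v : vertex G, u = v.
Proof.
move=> noE u v; have [[|x p] [/= + <-]] := conn u v => //.
by case/andP => /orP[] /set_mem /mk_edge [e].
Qed.

Hypothesis rev : with_reversed_edges G.

(** The first step of a path from [v] to the source of the given edge is an edge at [v], to be
    reversed if it enters [v]. If the path is empty, the given edge itself leaves [v]. *)
Lemma exists_out_edge (v : vertex G) :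
  edge G -> exists e : edge G, source e = v.
Proof.
move=> e0; have [[|x p] [/= + lastE]] := conn v (source e0).
  by exists e0.
case/andP => /orP[] /set_mem; last move/rev; move/mk_edge => [e [<- _]] _.
  by exists e.
by exists e.
Qed.

Lemma exists_in_edge (v : vertex G) :
  edge G -> exists e : edge G, target e = v.
Proof.
move=> /(exists_out_edge v) [e <-].
by have [d [_ <-]] := mk_edge (rev (edgeP e)); exists d.
Qed.

End Graph.

(** Non-edges all have the value [None], so agreement on the edges of both graphs amounts to
    agreement on all pairs. *)
Lemma is_isomorphismP (VL EL : Type) (G1 G2 : graph VL EL)
    (f : vertex G1 -> vertex G2) :
  is_isomorphism f <->
  [/\ bijective f, forall v, vlabel G1 v = vlabel G2 (f v)
    & forall u v, elabel_ext G1 (u, v) = elabel_ext G2 (f u, f v)].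
Proof.
split=> [[f' [[fK f'K] fX _ fY fY']]|[[f' fK f'K] fX fY]].
  split=> // [|u v]; first by exists f'.
  have [/fY //|nG1uv] := pselect (edge G1 (u, v)).
  have [/fY'|nG2uv] := pselect (edge G2 (f u, f v)); first by rewrite !fK.
  by rewrite !elabel_ext_None.
exists f'; split=> // [v'|u' v' _]; first by rewrite fX f'K.
by rewrite fY !f'K.
Qed.

(** An isomorphism of line graphs, expressed on the edges of the original graphs. *)
Definition is_edge_isomorphism (VL EL : Type) (G1 G2 : graph VL EL)
    (psi : edge G1 -> edge G2) : Prop :=
  [/\ bijective psi,
      forall e, elabel G1 e = elabel G2 (psi e),
      forall d e, target d = source e <-> target (psi d) = source (psi e)
    & forall d e, target d = source e ->
        vlabel G1 (target d) = vlabel G2 (target (psi d))].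

(** * Passage between vertex maps and edge maps *)

Section EdgeIsomorphism.
Variables (VL EL : Type).
Implicit Types G : graph VL EL.

Lemma edge_map_exists G1 G2 (f : vertex G1 -> vertex G2) :
  is_isomorphism f -> exists2 psi : edge G1 -> edge G2,
    is_edge_isomorphism psi &
    forall e, source (psi e) = f (source e) /\ target (psi e) = f (target e).
Proof.
move=> /is_isomorphismP [[f' fK f'K] fX fY].
have fE u v : edge G1 (u, v) <-> edge G2 (f u, f v).
  by rewrite !edge_isSome fY.
have /choice[psi psiP] (e : edge G1) : exists e' : edge G2,
    source e' = f (source e) /\ target e' = f (target e).
  by apply: mk_edge; rewrite -fE; apply: edgeP.
have /choice[psi' psi'P] (e' : edge G2) : exists e : edge G1,
    source e = f' (source e') /\ target e = f' (target e').
  by apply: mk_edge; rewrite fE !f'K; apply: edgeP.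
exists psi => //; split=> [|e|d e|d e _].
- exists psi' => e; apply: edge_ext.
  + by rewrite (psi'P _).1 (psiP _).1 fK.
  + by rewrite (psi'P _).2 (psiP _).2 fK.
  + by rewrite (psiP _).1 (psi'P _).1 f'K.
  + by rewrite (psiP _).2 (psi'P _).2 f'K.
- apply: Some_inj; rewrite -!elabel_ext_edge.
  by rewrite !val_edge (psiP e).1 (psiP e).2 fY.
- by rewrite (psiP _).1 (psiP _).2; split=> [->//|/(can_inj fK)].
- by rewrite (psiP _).2.
Qed.

Lemma is_edge_isomorphism_inv G1 G2 (psi : edge G1 -> edge G2) psi' :
    cancel psi psi' -> cancel psi' psi ->
  is_edge_isomorphism psi -> is_edge_isomorphism psi'.
Proof.
move=> psiK psi'K [_ psiY psiA psiX]; split=> [|e|d e|d e].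
- by exists psi.
- by rewrite psiY psi'K.
- by rewrite psiA !psi'K.
- by rewrite -{1}(psi'K d) -{1}(psi'K e) -psiA => /psiX ->; rewrite psi'K.
Qed.

(** The vertex map induced by [psi], as a relation so that inverting [psi] yields the converse.
    Between graphs without edges only the label condition has content. *)
Definition edge_corresp G1 G2 (psi : edge G1 -> edge G2)
    (v : vertex G1) (w : vertex G2) : Prop :=
  [/\ vlabel G1 v = vlabel G2 w,
      forall e, source e = v <-> source (psi e) = w
    & forall e, target e = v <-> target (psi e) = w].

Lemma edge_corresp_inv G1 G2 (psi : edge G1 -> edge G2) psi' v w :
  cancel psi' psi -> edge_corresp psi v w -> edge_corresp psi' w v.
Proof.
by move=> psi'K [vw vwS vwT]; split=> // e; rewrite ?vwS ?vwT psi'K.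
Qed.

Section Total.
Variables (G1 G2 : graph VL EL) (psi : edge G1 -> edge G2).
Hypotheses (conn1 : connected G1) (conn2 : connected G2).
Hypotheses (rev1 : with_reversed_edges G1).
Hypothesis psi_iso : is_edge_isomorphism psi.
Hypothesis edgeless : edge G1 = set0 -> edge G2 = set0 ->
  range (vlabel G1) = range (vlabel G2).

(** If there is an edge, the image of an edge leaving [v] dictates [w]. If there is none, [edgeless]
    supplies a vertex of [G2] with the label of [v], and connectedness leaves no other vertex. *)
Lemma edge_corresp_total v : exists! w, edge_corresp psi v w.
Proof.
have [[psi' psiK psi'K] psiY psiA psiX] := psi_iso.
have [[e0]|noE1] := pselect (inhabited (edge G1)).
  have [e eS] := exists_out_edge conn1 rev1 v e0.
  have [d dT] := exists_in_edge conn1 rev1 v e0.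
  have deA : target d = source e by rewrite dT eS.
  have deA' := (psiA d e).1 deA.
  exists (source (psi e)); split=> [|w [_ vwS _]]; last exact/vwS.
  split=> [|e1|d1].
  - by rewrite -dT -deA' (psiX d e).
  (* An edge leaves [v] exactly when it follows [d], and enters [v] exactly when [e] follows it;
     [psi] respects both. *)
  - by rewrite -dT -deA'; split=> /esym/psiA/esym.
  - by rewrite -eS psiA.
have noE2 (e : edge G2) : False by apply: noE1; exists; apply: psi' e.
have {}noE1 (e : edge G1) : False by apply: noE1; exists.
have [] : range (vlabel G2) (vlabel G1 v).
  rewrite -edgeless; first by exists v.
    by rewrite -subset0 => -[a b] /mk_edge [e]; have := noE1 e.
  by rewrite -subset0 => -[a b] /mk_edge [e]; have := noE2 e.
move=> w _ wv; exists w; split=> [|w' _]; last exact: edgeless_connected.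
by split=> // e; case: (noE1 e).
Qed.

End Total.

Variables (G1 G2 : graph VL EL).
Hypotheses (conn1 : connected G1) (conn2 : connected G2).
Hypotheses (rev1 : with_reversed_edges G1) (rev2 : with_reversed_edges G2).
Hypothesis edgeless : edge G1 = set0 -> edge G2 = set0 ->
  range (vlabel G1) = range (vlabel G2).

(** Totality and uniqueness, applied to [psi] and to its inverse, make [edge_corresp psi] the graph
    of a bijection. *)
Lemma vertex_map_exists (psi : edge G1 -> edge G2) :
  is_edge_isomorphism psi -> exists2 f : vertex G1 -> vertex G2,
    is_isomorphism f &
    forall e, source (psi e) = f (source e) /\ target (psi e) = f (target e).
Proof.
move=> psi_iso; have [[psi' psiK psi'K] psiY _ _] := psi_iso.
have [v|w|f [f' fK f'K] fP] := @bijective_of_rel _ _ (edge_corresp psi).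
- exact: edge_corresp_total.
- have [|v [vw uniq_v]] := edge_corresp_total conn2 conn1 rev2
    (is_edge_isomorphism_inv psiK psi'K psi_iso) _ w.
    by move=> E2 E1; rewrite edgeless.
  exists v; split=> [|v' /(edge_corresp_inv psi'K)]; last exact: uniq_v.
  exact: edge_corresp_inv vw.
have fpsi e : source (psi e) = f (source e) /\ target (psi e) = f (target e).
  have [_ sP _] := fP (source e); have [_ _ tP] := fP (target e).
  by split; [apply/sP | apply/tP].
exists f => //; apply/is_isomorphismP; split=> [|v|u v].
- by exists f'.
- by have [] := fP v.
have [/mk_edge [e [eu ev]]|nG1] := pselect (edge G1 (u, v)).
  have -> : (u, v) = val e by rewrite val_edge eu ev.
  have -> : (f u, f v) = val (psi e).
    by rewrite val_edge (fpsi e).1 (fpsi e).2 eu ev.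
  by rewrite !elabel_ext_edge psiY.
(* An edge from [f u] to [f v] would have a preimage under [psi] going from [u] to [v]. *)
rewrite !elabel_ext_None // => /mk_edge [e' [e'u e'v]]; apply: nG1.
have [_ uP _] := fP u; have [_ _ vP] := fP v.
rewrite -((uP (psi' e')).2 _) ?psi'K // -((vP (psi' e')).2 _) ?psi'K //.
exact: edgeP.
Qed.

(** Every vertex is a source as soon as [G1] has an edge. Otherwise [G2] has no edge either, hence
    at most one vertex. *)
Lemma vertex_map_unique (psi : edge G1 -> edge G2) (f f' : vertex G1 -> vertex G2) :
    bijective psi ->
    (forall e, source (psi e) = f (source e)) ->
    (forall e, source (psi e) = f' (source e)) ->
  f = f'.
Proof.
move=> [psi' _ _] fP f'P; apply: funext => v.
have [[e0]|noE1] := pselect (inhabited (edge G1)).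
  by have [e <-] := exists_out_edge conn1 rev1 v e0; rewrite -fP -f'P.
by apply: edgeless_connected conn2 _ _ _ => e; apply: noE1; exists; apply: psi' e.
Qed.

End EdgeIsomorphism.

(** * Line graphs and the correspondence of isomorphisms *)

Lemma line_graph_isomorphismP (VL EL : Type) (G1 G2 : graph VL EL)
    (H1 H2 : graph (set EL) VL)
    (g1 : edge G1 -> vertex H1) (g2 : edge G2 -> vertex H2) g1' g2'
    (phi : vertex H1 -> vertex H2) :
    cancel g1 g1' -> cancel g1' g1 -> cancel g2 g2' -> cancel g2' g2 ->
    (forall e, vlabel H1 (g1 e) = elabel G1 e) ->
    (forall e, vlabel H2 (g2 e) = elabel G2 e) ->
    (forall d e, edge H1 (g1 d, g1 e) <-> target d = source e) ->
    (forall d e, edge H2 (g2 d, g2 e) <-> target d = source e) ->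
    (forall d e, target d = source e ->
      elabel_ext H1 (g1 d, g1 e) = Some [set vlabel G1 (target d)]) ->
    (forall d e, target d = source e ->
      elabel_ext H2 (g2 d, g2 e) = Some [set vlabel G2 (target d)]) ->
  is_isomorphism phi <-> is_edge_isomorphism (fun e => g2' (phi (g1 e))).
Proof.
move=> g1K g1'K g2K g2'K X1 X2 E1 E2 Y1 Y2; rewrite is_isomorphismP; split.
  move=> [[phi' phiK phi'K] phiX phiY].
  have phiE d e :
      target d = source e <-> target (g2' (phi (g1 d))) = source (g2' (phi (g1 e))).
    by rewrite -E1 -E2 !g2'K !edge_isSome phiY.
  split=> // [|e|d e de].
  - exists (fun e => g1' (phi' (g2 e))) => e.
      by rewrite g2'K phiK g1K.
    by rewrite g1'K phi'K g2K.
  - by rewrite -X1 -X2 g2'K.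
  - have := Y2 _ _ ((phiE d e).1 de); rewrite !g2'K -phiY Y1 // => -[].
    (* Equality of the singleton label sets gives equality of the vertex labels. *)
    by move=> /seteqP[+ _]; apply.
move=> [[psi' psiK psi'K] psiY psiA psiX]; split=> [|v|u v].
- exists (fun h => g1 (psi' (g2' h))) => h.
    by rewrite -{1}(g1'K h) psiK g1'K.
  by rewrite -[LHS]g2'K psi'K g2'K.
- by rewrite -(g1'K v) X1 psiY -X2 g2'K.
rewrite -(g1'K u) -(g1'K v); move: (g1' u) (g1' v) => d e.
rewrite -(g2'K (phi (g1 d))) -(g2'K (phi (g1 e))).
(* Both sides are the singleton of the label of the common vertex, or both are [None]. *)
have [de|nde] := pselect (target d = source e).
  by rewrite Y1 // Y2 -?psiA // -(psiX d e).
by rewrite !elabel_ext_None ?E1 ?E2 -?psiA.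
Qed.

(** Two single vertices without edges and with different labels are not isomorphic, yet their empty
    line graphs are; [edgeless] excludes this, as well as a single vertex against the empty
    graph. *)
Theorem theorem6 (VL EL : Type) (G1 G2 : graph VL EL)
    (H1 H2 : graph (set EL) VL)
    (conn1 : connected G1) (conn2 : connected G2)
    (rev1 : with_reversed_edges G1) (rev2 : with_reversed_edges G2)
    (line1 : is_line_graph G1 H1) (line2 : is_line_graph G2 H2)
    (edgeless : edge G1 = set0 -> edge G2 = set0 ->
       range (vlabel G1) = range (vlabel G2)) :
  exists F : isomorphisms G1 G2 -> isomorphisms H1 H2, bijective F.
Proof.
have [g1 [[g1' g1K g1'K] X1 E1 Y1]] := line1.
have [g2 [[g2' g2K g2'K] X2 E2 Y2]] := line2.
have isoP phi := line_graph_isomorphismP phi g1K g1'K g2K g2'K X1 X2 E1 E2 Y1 Y2.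
(* [R f phi] says that [phi], read as a map of edges, acts on endpoints as [f]. *)
pose R (f : isomorphisms G1 G2) (phi : isomorphisms H1 H2) := forall e,
  source (g2' (val phi (g1 e))) = val f (source e) /\
  target (g2' (val phi (g1 e))) = val f (target e).
have [f|phi|F F_bij _] := @bijective_of_rel _ _ R; last by exists F.
- have [psi psi_iso psiP] := edge_map_exists (set_valP f).
  pose phi h := g2 (psi (g1' h)).
  have phiE : (fun e => g2' (phi (g1 e))) = psi.
    by apply: funext => e; rewrite /phi g1K g2K.
  have phi_iso : phi \in isomorphisms H1 H2.
    by apply: mem_set; apply/isoP; rewrite phiE.
  exists (exist _ phi phi_iso); split=> [e|phi2 Rphi2] /=.
    by rewrite (congr1 (@^~ e) phiE).
  (* Uniqueness of [phi]: an edge is determined by its endpoints, which [f] prescribes. *)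
  apply: val_inj; apply: funext => h /=.
  rewrite -(g2'K (val phi2 h)); congr g2; rewrite -{2}(g1'K h).
  by apply: edge_ext; rewrite ?(psiP _).1 ?(psiP _).2 ?(Rphi2 _).1 ?(Rphi2 _).2.
have psi_iso := (isoP _).1 (set_valP phi).
have [f f_iso fP] := vertex_map_exists conn1 conn2 rev1 rev2 edgeless psi_iso.
exists (exist _ f (mem_set f_iso)); split=> // f2 Rf2.
apply: val_inj => /=; have [psi_bij _ _ _] := psi_iso.
apply: (vertex_map_unique conn1 conn2 rev1 psi_bij) => e.
  exact: (fP e).1.
exact: (Rf2 e).1.
Qed.
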